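(* Let $\tau_k>0$, $\delta_k\ge 0$ and let $(x^k,y^k)\in\mathbb X\times D$. Assume that the sequence of linear maps $\{H_\ell\}$ in the Inexact Alternating Minimization algorithm (defined in the context), started from $(x^k,y^k)$, satisfies the bounded eigenvalues condition: there are constants $0<c_1\le c_2$ such that $$c_1\|z\|^2\le\langle z,H_\ell(z)\rangle\le c_2\|z\|^2\qquad\forall z\in\mathbb X,\ \forall\ell .$$ Then the algorithm cannot cycle infinitely and determines in a finite number of iterations a point $(x^{k+1},y^{k+1})$ such that $$\|\nabla_x q_{\tau_k}(x^{k+1},y^{k+1})\|\le\delta_k\quad\text{and}\quad y^{k+1}\in\operatorname{argmin}_{y\in D}q_{\tau_k}(x^{k+1},y).$$
   Context: Setting: $\mathbb X,\mathbb Y$ are Euclidean spaces (real finite-dimensional Hilbert spaces), $f:\mathbb X\to\mathbb R$ and $G:\mathbb X\to\mathbb Y$ are continuously differentiable, $C\subseteq\mathbb Y$ is nonempty, closed and convex, and $D\subseteq\mathbb X$ is nonempty and closed (not necessarily convex). Standing assumption: $f$ has bounded level sets, i.e. $\{x\in\mathbb X: f(x)\le\eta\}$ is bounded for every $\eta\in\mathbb R$. Notation: $\mathrm{dist}_C(y)=\min_{z\in C}\|z-y\|$; $\Pi_D(x)=\operatorname{argmin}_{z\in D}\|z-x\|$ (set-valued). For $\tau>0$, $q_\tau(x,y)=f(x)+\frac{\tau}{2}\big(\|x-y\|^2+\mathrm{dist}_C^2(G(x))\big)$ on $\mathbb X\times\mathbb X$; $\nabla_x q_\tau$ is its gradient with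 respect to $x$. The index $k$ is fixed. Inexact Alternating Minimization: given $\delta_k\ge 0$, $\tau_k>0$, a starting point $(x^k,y^k)\in\mathbb X\times D$ and $\gamma,\beta\in(0,1)$, set $\ell=0$ and $(u^0,v^0)=(x^k,y^k)$. (S.1) If $\|\nabla_x q_{\tau_k}(u^\ell,v^\ell)\|\le\delta_k$, stop and return $(x^{k+1},y^{k+1})=(u^\ell,v^\ell)$. (S.2) Choose a positive definite self-adjoint linear map $H_\ell:\mathbb X\to\mathbb X$, set $d^\ell=-H_\ell(\nabla_x q_{\tau_k}(u^\ell,v^\ell))$ and compute $$\alpha_\ell=\max_{j\in\{0,1,2,\dots\}}\{\beta^j: q_{\tau_k}(u^\ell+\beta^jd^\ell,v^\ell)\le q_{\tau_k}(u^\ell,v^\ell)+\gamma\beta^j\langle\nabla_xq_{\tau_k}(u^\ell,v^\ell),d^\ell\rangle\}.$$ (S.3) Set $u^{\ell+1}=u^\ell+\alpha_\ell d^\ell$. (S.4) Compute $v^{\ell+1}\in\operatorname{argmin}_{v\in D}q_{\tau_k}(u^{\ell+1},v)=\Pi_D(u^{\ell+1})$. (S.5) Set $\ell\leftarrow\ell+1$ and go to (S.1).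
   Formalization: Finite termination is proved for δ_k>0 only (it can fail for δ_k=0); y^{k+1} in the argmin is claimed only if at least one iteration is performed or y^k already minimizes q(x^k,·) over D (it can fail when the algorithm stops at ℓ=0). *)

(* Defs.v *)
From HB Require Import structures.
From mathcomp Require Import all_boot all_order all_algebra.
From mathcomp Require Import all_classical all_reals all_analysis.

Set Implicit Arguments.
Unset Strict Implicit.
Unset Printing Implicit Defensive.

Import Order.TTheory GRing.Theory Num.Theory.
Import numFieldNormedType.Exports.

Local Open Scope classical_set_scope.
Local Open Scope ring_scope.

(* Euclidean space: a finite-dimensional ([Vector]) real normed space whose
   norm comes from an inner product.  Linearity of [inner] in its second
   argument follows from symmetry, definiteness from [normr_inner]. *)
HB.mixin Record NormedModule_isEuclidean (R : realType) V
    & NormedModule R V & Vector R V := {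
  inner : V -> V -> R ;
  innerC : forall x y : V, inner x y = inner y x ;
  innerPl : forall (a : R) (x y z : V),
    inner (a *: x + y) z = a * inner x z + inner y z ;
  normr_inner : forall x : V, `|x| ^+ 2 = inner x x
}.

#[short(type="euclideanType")]
HB.structure Definition Euclidean (R : realType) :=
  {V of NormedModule R V & Vector R V & NormedModule_isEuclidean R V}.

(* The second clause is continuity of x |-> 'd F x for the operator norm. *)
Definition continuously_differentiable (R : realType) (V W : normedModType R)
    (F : V -> W) : Prop :=
  (forall x, differentiable F x) /\
  (forall x (e : R), 0 < e ->
     \forall x' \near x, forall v, `|'d F x' v - 'd F x v| <= e * `|v|).

(* Riesz representative of the differential; meaningful where [h] is
   differentiable. *)
Definition gradient (R : realType) (X : euclideanType R) (h : X -> R) (x : X)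
    : X :=
  xget 0 [set g | forall v, 'd h x v = inner g v].

Definition argmin (R : realType) (T : Type) (A : set T) (h : T -> R) : set T :=
  [set z | A z /\ forall z', A z' -> h z <= h z'].

(* For a nonempty closed set [C] of a Euclidean space the infimum is attained. *)
Definition dist (R : realType) (Y : euclideanType R) (C : set Y) (y : Y) : R :=
  inf [set `|z - y| | z in C].

Definition self_adjoint (R : realType) (X : euclideanType R) (H : X -> X)
    : Prop :=
  forall z w, inner (H z) w = inner z (H w).

Definition positive_definite (R : realType) (X : euclideanType R) (H : X -> X)
    : Prop :=
  forall z, z != 0 -> 0 < inner z (H z).

Section AlternatingMinimization.
Context {R : realType} {X Y : euclideanType R}.
Variables (f : X -> R) (G : X -> Y) (C : set Y) (D : set X).
Variables (tau delta gamma beta : R).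

Definition penalty (x y : X) : R :=
  f x + tau / 2 * (`|x - y| ^+ 2 + dist C (G x) ^+ 2).

Definition grad_penalty (x y : X) : X := gradient (penalty ^~ y) x.

Definition iam_stop (p : X * X) : Prop := `|grad_penalty p.1 p.2| <= delta.

Definition armijo_steps (u v d : X) : set R :=
  [set a | exists2 j : nat, a = beta ^+ j &
     penalty (u + a *: d) v
       <= penalty u v + gamma * a * inner (grad_penalty u v) d].

(* Steps (S.2)-(S.4) with the map [H]: the stepsize is the maximum of the
   Armijo set, and p'.2 may be any of the minimizers. *)
Definition iam_update (H : X -> X) (p p' : X * X) : Prop :=
  let d := - H (grad_penalty p.1 p.2) in
  exists alpha : R,
    [/\ armijo_steps p.1 p.2 d alpha,
        ubound (armijo_steps p.1 p.2 d) alpha,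
        p'.1 = p.1 + alpha *: d &
        argmin D (penalty p'.1) p'.2].

(* w l is the pair (u^l, v^l).  As long as the stopping test has failed, the
   iterates follow the algorithm; past the first success w is unconstrained. *)
Definition iam_execution (H : nat -> X -> X) (p0 : X * X) (w : nat -> X * X)
    : Prop :=
  w 0%N = p0 /\
  forall l : nat, (forall i : nat, (i <= l)%N -> ~ iam_stop (w i)) ->
    iam_update (H l) (w l) (w l.+1).

Definition iam_returns_at (w : nat -> X * X) (N : nat) : Prop :=
  iam_stop (w N) /\ forall i : nat, (i < N)%N -> ~ iam_stop (w i).

End AlternatingMinimization.

(* Main.v *)
Require Import Defs.
From HB Require Import structures.
From mathcomp Require Import all_boot all_order all_algebra.
From mathcomp Require Import all_classical all_reals all_analysis.
From mathcomp Require Import ring lra.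

(** Every update decreases the penalty function [q = penalty f G C tau]: the
    Armijo test makes the move in the first variable a descent step, and
    projecting onto [D] minimizes [q] in the second variable.  All iterates
    therefore stay in one sublevel set of [q], which is bounded because [f] has
    bounded sublevel sets and the proximal term [|x - y|^2] ties the second
    variable to the first ([sublevel_compact]).  If the stopping test never
    succeeded, the gradient would have norm at least [delta > 0] along the
    whole run, and by compactness the iterates would have a cluster point.  Around
    any point one fixed step [beta ^ j] passes the Armijo test for all such
    large gradients and all admissible maps [H] ([backtracking_accepts]), so
    that infinitely many updates would decrease [q] by at least
    [gamma * beta ^ j * c1 * delta ^ 2].  This contradicts the lower bound on
    [q] inherited from [f].

    The uniform Armijo step needs [q] to be differentiable in [x] with a
    gradient that is jointly continuous in [(x, y)]
    ([grad_penalty_continuous]); the mean value theorem then compares [q] with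
    its linearization along the search direction.  The only delicate term is
    the squared distance to the convex set [C]: comparing nearest points, and
    using that the projection onto [C] is 1-Lipschitz, shows that
    [2 (y - p)], with [p] the projection of [y], linearizes it at [y] with an
    error of at most [|h|^2] ([dist_sqr_expansion]).

    The same local Armijo lemma, applied at a single point with a nonzero
    gradient, shows that the line search of each step ends, so that every step
    of the algorithm can be carried out ([iam_update_exists]). *)

Set Implicit Arguments.
Unset Strict Implicit.
Unset Printing Implicit Defensive.

Import Order.TTheory GRing.Theory Num.Theory.
Import numFieldNormedType.Exports.

Local Open Scope classical_set_scope.
Local Open Scope ring_scope.

(** * Inner products *)

Section InnerProduct.
Context {R : realType} {X : euclideanType R}.
Implicit Types (x y z : X) (a : R).

Lemma innerDl x y z : inner (x + y) z = inner x z + inner y z.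
Proof. by rewrite -[x]scale1r innerPl mul1r scale1r. Qed.

Lemma inner0l z : inner 0 z = 0.
Proof. by apply: (@addrI _ (inner 0 z)); rewrite -innerDl !addr0. Qed.

Lemma innerZl a x z : inner (a *: x) z = a * inner x z.
Proof. by rewrite -[a *: x]addr0 innerPl inner0l addr0. Qed.

Lemma innerNl x z : inner (- x) z = - inner x z.
Proof. by rewrite -scaleN1r innerZl mulN1r. Qed.

Lemma innerBl x y z : inner (x - y) z = inner x z - inner y z.
Proof. by rewrite innerDl innerNl. Qed.

Lemma innerDr z x y : inner z (x + y) = inner z x + inner z y.
Proof. by rewrite innerC innerDl !(innerC z). Qed.

Lemma innerZr z a x : inner z (a *: x) = a * inner z x.
Proof. by rewrite innerC innerZl innerC. Qed.

Lemma innerNr z x : inner z (- x) = - inner z x.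
Proof. by rewrite innerC innerNl innerC. Qed.

Lemma innerBr z x y : inner z (x - y) = inner z x - inner z y.
Proof. by rewrite innerDr innerNr. Qed.

Lemma sqr_normD x y : `|x + y| ^+ 2 = `|x| ^+ 2 + 2 * inner x y + `|y| ^+ 2.
Proof. by rewrite !normr_inner innerDl !innerDr (innerC y x); ring. Qed.

(** Cauchy-Schwarz for a form that may be degenerate: it serves both for the
    inner product and for the form [<z, H w>] of a positive definite map. *)
Lemma semidefinite_schwarz (b : X -> X -> R) :
    (forall x y, b x y = b y x) ->
    (forall a x y z, b (a *: x + y) z = a * b x z + b y z) ->
    (forall x, 0 <= b x x) ->
  forall x y, b x y ^+ 2 <= b x x * b y y.
Proof.
move=> bC bP b_ge0 x y.
have quad t : 0 <= t ^+ 2 * b y y + 2 * t * b x y + b x x.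
  have := b_ge0 (t *: y + x).
  rewrite bP (bC y) bP (bC x (t *: y + x)) bP (bC y x).
  by congr (_ <= _); ring.
have [yy0|] := eqVneq (b y y) 0.
  have [->|xy_neq0] := eqVneq (b x y) 0; first by rewrite expr0n/= yy0 mulr0.
  (* a nonconstant affine function of [t] takes negative values *)
  have := quad (- (b x x + 1) / (2 * b x y)).
  have -> : 2 * (- (b x x + 1) / (2 * b x y)) * b x y = - (b x x + 1).
    by field.
  by rewrite yy0; lra.
move=> yy_neq0; have yy_gt0 : 0 < b y y by rewrite lt0r yy_neq0 b_ge0.
have := quad (- b x y / b y y).
have -> : (- b x y / b y y) ^+ 2 * b y y + 2 * (- b x y / b y y) * b x y + b x x
  = (b x x * b y y - b x y ^+ 2) / b y y by field; rewrite gt_eqF.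
by rewrite pmulr_lge0 ?invr_gt0// subr_ge0.
Qed.

Lemma inner_norm_le x y : `|inner x y| <= `|x| * `|y|.
Proof.
rewrite -ler_sqr ?nnegrE ?mulr_ge0// real_normK ?num_real// exprMn !normr_inner.
apply: semidefinite_schwarz => [|? ? ? ?|z]; first exact: innerC.
  exact: innerPl.
by rewrite -normr_inner sqr_ge0.
Qed.

Lemma inner_le x y : inner x y <= `|x| * `|y|.
Proof. exact: le_trans (ler_norm _) (inner_norm_le _ _). Qed.

Lemma inner_inj x y : (forall z, inner x z = inner y z) -> x = y.
Proof.
move=> xy; apply/eqP; rewrite -subr_eq0 -normr_eq0 -sqrf_eq0 normr_inner.
by rewrite innerBl xy subrr.
Qed.

(** A self-adjoint map is bounded by its largest eigenvalue: the Schwarz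
    inequality for [<z, H w>] between [H z] and [z] gives
    [|H z|^4 <= c |H z|^2 * c |z|^2]. *)
Lemma self_adjoint_norm_le (H : {linear X -> X}) c :
    self_adjoint H -> 0 <= c ->
    (forall z, 0 <= inner z (H z) <= c * `|z| ^+ 2) ->
  forall z, `|H z| <= c * `|z|.
Proof.
move=> Hsa c_ge0 Hc z.
have [->|Hz_neq0] := eqVneq (H z) 0; first by rewrite normr0 mulr_ge0.
have Hz_gt0 : 0 < `|H z| ^+ 2 by rewrite exprn_gt0// normr_gt0.
have HC x y : inner x (H y) = inner y (H x) by rewrite -Hsa innerC.
have HP a x y t : inner (a *: x + y) (H t) = a * inner x (H t) + inner y (H t).
  exact: innerPl.
have H_ge0 x : 0 <= inner x (H x) by case/andP: (Hc x).
have := semidefinite_schwarz HC HP H_ge0 (H z) z.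
rewrite -normr_inner => sch.
have {}sch : (`|H z| ^+ 2) ^+ 2 <= (c * `|H z| ^+ 2) * (c * `|z| ^+ 2).
  rewrite (le_trans sch)//; case/andP: (Hc (H z)) => ? ?.
  by case/andP: (Hc z) => ? ?; exact: ler_pM.
rewrite -ler_sqr ?nnegrE ?mulr_ge0// -(ler_pM2l Hz_gt0).
by move: sch; rewrite expr2 exprMn; congr (_ <= _); ring.
Qed.
End InnerProduct.

(** * Riesz representation and compactness *)

Section FiniteDimension.
Context {R : realType} {X : euclideanType R}.
Import VectorInternalTheory.

Let n := dim X.
Local Notation r2vX := (@r2v R X).
Let e (i : 'I_n) : X := r2vX (delta_mx 0 i).

Let r2v_sum (a : 'rV[R]_n) : r2vX a = \sum_i a 0 i *: e i.
Proof.
rewrite [in LHS](row_sum_delta a) linear_sum.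
by apply: eq_bigr => i _; rewrite linearZ.
Qed.

(** Riesz representation.  The Gram matrix of the coordinate basis is
    invertible because its quadratic form is the squared norm, and the
    representative solves the linear system that it defines. *)
Lemma riesz (L : {linear X -> R}) : exists g, forall x, L x = inner g x.
Proof.
pose M : 'M[R]_n := \matrix_(i, j) inner (e i) (e j).
have inner_r2v (a : 'rV[R]_n) x :
    inner (r2vX a) x = \sum_i a 0 i * inner (e i) x.
  rewrite r2v_sum; elim/big_rec2 : _ => [|i y1 y2 _ <-]; first exact: inner0l.
  by rewrite innerDl innerZl.
have inner_r2v_e (a : 'rV[R]_n) j : inner (r2vX a) (e j) = (a *m M) 0 j.
  by rewrite inner_r2v mxE; apply: eq_bigr => i _; rewrite mxE.
have Munit : M \in unitmx.
  rewrite -row_free_unit; apply: inj_row_free => a aM0.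
  apply: (@r2v_inj R X); rewrite linear0; apply: inner_inj => z.
  rewrite inner0l -(v2rK z) innerC inner_r2v big1// => i _.
  by rewrite innerC inner_r2v_e aM0 mxE mulr0.
exists (r2vX ((\row_j L (e j)) *m invmx M)) => x.
rewrite -(v2rK x) innerC inner_r2v [in LHS]r2v_sum linear_sum.
apply: eq_bigr => i _; rewrite linearZ innerC inner_r2v_e mulmxKV//.
by rewrite mxE.
Qed.

Let r2v_continuous : continuous (r2vX : 'rV[R]_n -> X).
Proof.
have -> : (r2vX : 'rV[R]_n -> X) = fun a => \sum_i a 0 i *: e i.
  by apply/funext => a; exact: r2v_sum.
apply: continuous_big; first exact: add_continuous.
move=> i _ a; apply: cvgZr_tmp; first exact: nbhs_filter.
exact: coord_continuous.
Qed.

(** The coordinate functionals are bounded by Riesz and Cauchy-Schwarz, so that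
    coordinates transport the statement to row vectors. *)
Lemma bounded_closed_compact_euclidean (A : set X) (M : R) :
  (forall x, A x -> `|x| <= M) -> closed A -> compact A.
Proof.
move=> AM Acl.
pose B : set 'rV[R]_n := [set a | A (r2vX a)].
have coord_le i : exists k : R, forall x : X, `|v2r x 0 i| <= k * `|x|.
  have coord_linear : linear (fun x : X => v2r x 0 i : R).
    by move=> a x y; rewrite linearP !mxE.
  pose cL := GRing.isLinear.Build _ _ _ _ _ coord_linear.
  pose c : {linear X -> R} := HB.pack (fun x : X => v2r x 0 i : R) cL.
  have [g gE] := riesz c; exists `|g| => x.
  by rewrite -[v2r x 0 i]/(c x) gE inner_norm_le.
have [k kP] := choice coord_le.
have Bcompact : compact B.
  apply: bounded_closed_compact.
    exists (\sum_i `|k i| * `|M|); split => [|K /ltW ltK a Ba].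
      exact: num_real.
    apply: le_trans ltK.
    have M_ge0 : 0 <= M by rewrite (le_trans _ (AM _ Ba)).
    rewrite [leLHS]/Num.norm/= mx_normrE.
    apply/bigmax_leP; split => [|[i0 j] _ /=].
      by apply: sumr_ge0 => i _; rewrite mulr_ge0.
    rewrite (ord1 i0) (bigD1 j)//= -[leLHS]addr0 lerD//; last first.
      by apply: sumr_ge0 => i _; rewrite mulr_ge0.
    rewrite -{1}(@r2vK R X a) (le_trans (kP _ _))//.
    apply: (le_trans (ler_wpM2r _ (ler_norm _))) => //.
    by rewrite ler_wpM2l// (ger0_norm M_ge0) AM.
  by apply: preimage_closed => // a _; exact: r2v_continuous.
suff <- : r2vX @` B = A.
  by apply: continuous_compact => //; exact: continuous_subspaceT.
apply/seteqP; split => [_ [a Ba <-]//|x Ax].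
by exists (v2r x); rewrite /B/= v2rK.
Qed.

End FiniteDimension.

(** * Nearest points and the squared distance *)

Section Projection.
Context {R : realType} {Y : euclideanType R}.
Variable C : set Y.
Hypotheses (C_neq0 : C !=set0) (C_closed : closed C).

Let norm_subr_continuous y : continuous (fun z : Y => `|z - y| : R).
Proof.
move=> z; apply: (@cvg_norm _ Y); apply: cvgB; [exact: cvg_id|exact: cvg_cst].
Qed.

(** Only the part of [C] in a ball around [y] competes, and it is compact. *)
Lemma nearest_point_exists y : exists p, argmin C (fun z => `|z - y|) p.
Proof.
have [c Cc] := C_neq0.
pose K := C `&` [set z | `|z - y| <= `|c - y|].
have Kcompact : compact K.
  apply: (@bounded_closed_compact_euclidean _ _ _ (`|c - y| + `|y|)).
    move=> z [_ /= zy]; rewrite -[z in leLHS](subrK y).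
    by rewrite (le_trans (ler_normD _ _))// lerD2r.
  apply: closedI => //.
  apply: (@preimage_closed _ _ (fun z => `|z - y|) [set r | r <= `|c - y|]).
    by move=> z _; exact: norm_subr_continuous.
  exact: closed_le.
have [||p + pmin] := compact_EVT_min _ Kcompact (f := fun z => `|z - y|).
- by exists c; split => /=.
- exact/continuous_subspaceT/norm_subr_continuous.
rewrite inE => -[Cp /= py]; exists p; split => // z Cz.
have [zy|/ltW yz] := leP `|z - y| `|c - y|; last exact: le_trans py yz.
by apply: pmin; rewrite inE; split.
Qed.

Definition nearest_point y : Y := xget 0 (argmin C (fun z => `|z - y|)).

Lemma nearest_pointP y : argmin C (fun z => `|z - y|) (nearest_point y).
Proof.
have [p yp] := nearest_point_exists y.
exact: (xgetPex 0 (ex_intro (argmin C (fun z => `|z - y|)) p yp)).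
Qed.

Lemma dist_nearest_point y p : argmin C (fun z => `|z - y|) p ->
  dist C y = `|p - y|.
Proof.
move=> [Cp pmin]; apply/eqP; rewrite eq_le; apply/andP; split.
  apply: ge_inf; last by exists p.
  by exists 0 => _ [z _ <-].
by apply: lb_le_inf; [exists `|p - y|, p|move=> _ [z Cz <-]; exact: pmin].
Qed.

Hypothesis C_convex : convex_set C.

(** Moving from the nearest point towards [z] inside [C] cannot decrease the
    distance to first order. *)
Lemma nearest_point_obtuse y p z : argmin C (fun z => `|z - y|) p -> C z ->
  inner (y - p) (z - p) <= 0.
Proof.
move=> [Cp pmin] Cz; rewrite leNgt; apply/negP => a_gt0.
set a := inner _ _ in a_gt0; pose b := `|z - p| ^+ 2.
have b_ge0 : 0 <= b by exact: sqr_ge0.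
have ab_gt0 : 0 < a + b + 1 by lra.
(* a step length with [t * b < 2 * a] *)
pose t := a / (a + b + 1).
have t_gt0 : 0 < t by rewrite divr_gt0.
have t_le1 : t <= 1 by rewrite ler_pdivrMr//; lra.
have Cpt : C (p + t *: (z - p)).
  have -> : p + t *: (z - p) = t *: z + (1 - t) *: p.
    by rewrite scalerBr scalerBl scale1r addrCA.
  apply/set_mem.
  exact: (@C_convex z p (Itv01 (ltW t_gt0) t_le1) (mem_set Cz) (mem_set Cp)).
have := pmin _ Cpt; rewrite -ler_sqr ?nnegrE// addrAC [leRHS]sqr_normD.
rewrite normrZ exprMn real_normK ?num_real// innerZr -(opprB y p) innerNl.
rewrite -/a -/b.
rewrite normrN (_ : t ^+ 2 * b = t * (t * b)); last by ring.
have tb : t * b < a.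
  by rewrite mulrAC ltr_pdivrMr// ltr_pM2l//; lra.
have : t * (t * b) < t * a by rewrite ltr_pM2l.
have : 0 < t * a by rewrite mulr_gt0.
lra.
Qed.

(** Firm nonexpansiveness of the projection: add up the two obtuse-angle
    inequalities. *)
Lemma nearest_point_monotone y y' p p' :
    argmin C (fun z => `|z - y|) p -> argmin C (fun z => `|z - y'|) p' ->
  `|p' - p| ^+ 2 <= inner (y' - y) (p' - p).
Proof.
move=> py py'.
have := nearest_point_obtuse py (proj1 py').
have := nearest_point_obtuse py' (proj1 py).
rewrite normr_inner !(innerBl, innerBr) (innerC p p').
lra.
Qed.

Lemma nearest_point_lipschitz y y' p p' :
    argmin C (fun z => `|z - y|) p -> argmin C (fun z => `|z - y'|) p' ->
  `|p' - p| <= `|y' - y|.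
Proof.
move=> py py'; have := nearest_point_monotone py py'.
have [->|pp] := eqVneq (p' - p) 0; first by rewrite normr0.
by move=> /le_trans/(_ (inner_le _ _)); rewrite expr2 ler_pM2r// normr_gt0.
Qed.

(** The upper bound tests the distance of [y + h] against [p], the lower bound
    that of [y] against the nearest point of [y + h]; the cross term that
    appears is controlled by the Lipschitz bound. *)
Lemma dist_sqr_expansion y p h : argmin C (fun z => `|z - y|) p ->
  `|dist C (y + h) ^+ 2 - dist C y ^+ 2 - inner (2 *: (y - p)) h| <= `|h| ^+ 2.
Proof.
move=> py; have [p' py'] := nearest_point_exists (y + h).
rewrite (dist_nearest_point py) (dist_nearest_point py').
have up : `|p' - (y + h)| ^+ 2 <= `|p - (y + h)| ^+ 2.
  by rewrite ler_sqr ?nnegrE//; exact: py'.2 py.1.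
have lo : `|p - y| ^+ 2 <= `|p' - y| ^+ 2.
  by rewrite ler_sqr ?nnegrE//; exact: py.2 py'.1.
have cross : inner h (p' - p) <= `|h| ^+ 2.
  have := nearest_point_lipschitz py py'; rewrite (addrC y) addrK => pp.
  by rewrite (le_trans (inner_le _ _))// expr2 ler_wpM2l.
rewrite innerZl ler_norml; move: up lo cross.
rewrite !normr_inner !(innerBl, innerDl, innerBr, innerDr).
rewrite (innerC y p) (innerC y p') (innerC h p) (innerC h p').
rewrite (innerC h y) => up lo cross; apply/andP; split; lra.
Qed.

End Projection.

(** * The gradient of the penalty function *)

Section Gradient.
Context {R : realType} {X : euclideanType R}.

(** ['d h x] is a linear form by construction, so that the set from which
    [gradient] chooses is inhabited. *)
Lemma gradientP (h : X -> R) x v : 'd h x v = inner (gradient h x) v.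
Proof.
have [g gE] := riesz ('d h x : {linear X -> R}).
by apply: (@xgetPex _ 0 [set g | forall v, 'd h x v = inner g v]); exists g.
Qed.

(** A quadratic error term is in particular negligible at first order. *)
Lemma is_diff_quadratic (phi : X -> R) x a :
    (forall h, `|phi (x + h) - phi x - inner a h| <= `|h| ^+ 2) ->
  is_diff x phi (inner a).
Proof.
move=> phiE.
have inner_linear : linear (inner a : X -> R).
  by move=> k y z; rewrite innerDr innerZr.
pose iL := GRing.isLinear.Build _ _ _ _ _ inner_linear.
pose L : {linear X -> R} := HB.pack (inner a : X -> R) iL.
have Lcont : continuous (L : X -> R).
  apply/linear_bounded_continuous/linear_boundedP.
  exists `|a|; split => [|r /ltW ar y]; first exact: num_real.
  by rewrite (le_trans (inner_norm_le a y))// ler_wpM2r.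
have dL : phi \o shift x = cst (phi x) + L +o_ 0 id.
  apply/eqaddoP => e e_gt0; apply/nbhs_norm0P; exists e => //= h /ltW he.
  rewrite (_ : (_ - _) h = phi (x + h) - phi x - inner a h); last first.
    by rewrite !fctE/= opprD addrA (addrC h).
  by rewrite (le_trans (phiE h))// expr2 ler_wpM2r.
have dE := diff_unique Lcont dL.
split; last exact: dE.
by apply/diff_locallyP; rewrite dE.
Qed.

End Gradient.

Section Penalty.
Context {R : realType} {X Y : euclideanType R}.
Variables (f : X -> R) (G : X -> Y) (C : set Y) (tau : R).
Hypotheses (f_C1 : continuously_differentiable f).
Hypotheses (G_C1 : continuously_differentiable G).
Hypotheses (C_neq0 : C !=set0) (C_closed : closed C) (C_convex : convex_set C).
Local Notation q := (penalty f G C tau).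
Local Notation grad := (grad_penalty f G C tau).

Local Notation P := (nearest_point C).
Let PC : forall y, argmin C (fun z => `|z - y|) (P y) :=
  nearest_pointP C_neq0 C_closed.

(** The chain rule applied to [q], with the projection giving the gradient of
    the squared distance. *)
Definition diff_penalty x v h : R :=
  'd f x h + tau * (inner (x - v) h + inner (G x - P (G x)) ('d G x h)).

Lemma is_diff_penalty x v : is_diff x (q ^~ v) (diff_penalty x v).
Proof.
pose N z : R := `|z - v| ^+ 2; pose S y : R := dist C y ^+ 2.
have dN : is_diff x N (inner (2 *: (x - v))).
  apply: is_diff_quadratic => h; rewrite /N (addrAC x) sqr_normD innerZl.
  by rewrite (_ : _ - _ - _ = `|h| ^+ 2) ?ger0_norm ?sqr_ge0//; ring.
have dS : is_diff (G x) S (inner (2 *: (G x - P (G x)))).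
  by apply: is_diff_quadratic => h; exact: dist_sqr_expansion.
have df : is_diff x f ('d f x) by apply: differentiableP; exact: f_C1.1.
have dG : is_diff x G ('d G x) by apply: differentiableP; exact: G_C1.1.
have -> : q ^~ v = f + (tau / 2) *: (N + (S \o G)) by apply/funext.
have dSG := is_diff_comp dG dS.
have dq' := is_diffD df (is_diffZ (tau / 2) (is_diffD dN dSG)).
apply: (is_diff_eq dq').
apply/funext => h; rewrite /diff_penalty fctE; congr (_ + _).
rewrite -[LHS]/(tau / 2 * (inner (2 *: (x - v)) h
  + inner (2 *: (G x - P (G x))) ('d G x h))) !innerZl.
by field.
Qed.

Lemma grad_penaltyE x v h : inner (grad x v) h = diff_penalty x v h.
Proof.
rewrite -gradientP; have [_ E] := is_diff_penalty x v.
exact: (congr1 (fun F : X -> R => F h) E).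
Qed.

Hypothesis tau_gt0 : 0 < tau.

(** With [h] the difference of two gradients, [|h|^2] is the difference of two
    differentials at [h], in which every term is [O(e' |h|)]. *)
Lemma grad_penalty_continuous : continuous (fun p : X * X => grad p.1 p.2).
Proof.
move=> [x0 v0]; apply/cvgrPdist_le => e e_gt0 /=.
pose rho x := G x - P (G x).
have [k k_gt0 kP] : exists2 k, 0 < k & forall h, `|'d G x0 h| <= k * `|h|.
  by apply: linear_lipschitz; apply: diff_continuous; exact: G_C1.1.
(* [e' * K] bounds the total variation of the differential *)
pose K := 1 + tau * (2 + k + `|rho x0|).
have K_gt0 : 0 < K by rewrite addr_gt0// mulr_gt0// ltr_wpDr// addr_gt0.
pose e' := Num.min 1 (e / K).
have e'_gt0 : 0 < e' by rewrite lt_min ltr01 divr_gt0.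
have near1 (A : set X) : nbhs x0 A -> \forall p \near (x0, v0), A p.1.
  exact: cvg_fst.
have G_near : \forall x \near x0, `|G x0 - G x| <= e' / 2.
  have /differentiable_continuous/cvgrPdist_le := G_C1.1 x0.
  by apply; rewrite divr_gt0.
have d_near : \forall p \near (x0, v0), `|(x0 - v0) - (p.1 - p.2)| <= e'.
  have : (p.1 - p.2) @[p --> (x0, v0)] --> x0 - v0.
    by apply: cvgB; [exact: cvg_fst|exact: cvg_snd].
  by move/cvgrPdist_le; apply.
near=> p.
have df_le h : `|'d f (p.1) h - 'd f x0 h| <= e' * `|h|.
  by move: h; near: p; exact: near1 (f_C1.2 x0 e' e'_gt0).
have dG_le h : `|'d G (p.1) h - 'd G x0 h| <= e' * `|h|.
  by move: h; near: p; exact: near1 (G_C1.2 x0 e' e'_gt0).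
have rho_le : `|rho p.1 - rho x0| <= e'.
  have G_le : `|G x0 - G p.1| <= e' / 2 by near: p; exact: near1 G_near.
  rewrite distrC in G_le.
  have P_le := nearest_point_lipschitz C_convex (PC (G x0)) (PC (G p.1)).
  have -> : rho p.1 - rho x0 = (G p.1 - G x0) - (P (G p.1) - P (G x0)).
    by rewrite /rho !opprB addrACA [RHS]addrACA [- P _ + _]addrC.
  rewrite (le_trans (ler_normB _ _))// (splitr e') lerD//.
  exact: le_trans P_le G_le.
have d_le : `|(p.1 - p.2) - (x0 - v0)| <= e'.
  by rewrite distrC; near: p.
rewrite distrC; set h := _ - _.
have dq_le : diff_penalty p.1 p.2 h - diff_penalty x0 v0 h <= e' * K * `|h|.
  rewrite /diff_penalty -/(rho _) -/(rho x0).
  have -> : inner (rho p.1) ('d G (p.1) h) =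
      inner (rho p.1 - rho x0) ('d G (p.1) h)
      + inner (rho x0) ('d G (p.1) h - 'd G x0 h) + inner (rho x0) ('d G x0 h).
    by rewrite innerBl innerBr; ring.
  have h1 : 'd f (p.1) h - 'd f x0 h <= e' * `|h|.
    exact: le_trans (ler_norm _) (df_le h).
  have h2 : inner (p.1 - p.2) h - inner (x0 - v0) h <= e' * `|h|.
    by rewrite -innerBl (le_trans (inner_le _ _))// ler_wpM2r.
  have h3 : inner (rho p.1 - rho x0) ('d G (p.1) h) <= e' * (1 + k) * `|h|.
    rewrite (le_trans (inner_le _ _))// -mulrA ler_pM//.
    rewrite -['d G (p.1) h](subrK ('d G x0 h)) (le_trans (ler_normD _ _))//.
    rewrite mulrDl lerD// (le_trans (dG_le h))// ler_wpM2r//.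
    by rewrite ge_min lexx.
  have h4 : inner (rho x0) ('d G (p.1) h - 'd G x0 h) <= e' * `|rho x0| * `|h|.
    by rewrite (le_trans (inner_le _ _))// mulrAC [leRHS]mulrC ler_wpM2l.
  have : tau * (inner (p.1 - p.2) h - inner (x0 - v0) h
      + inner (rho p.1 - rho x0) ('d G (p.1) h)
      + inner (rho x0) ('d G (p.1) h - 'd G x0 h))
      <= tau * (e' * `|h| + e' * (1 + k) * `|h| + e' * `|rho x0| * `|h|).
    by rewrite ler_pM2l// !lerD.
  rewrite /K; move: h1; lra.
have [->|h_neq0] := eqVneq h 0; first by rewrite normr0 ltW.
have h_gt0 : 0 < `|h| by rewrite normr_gt0.
rewrite -(ler_pM2r h_gt0) -expr2 normr_inner {1}/h innerBl !grad_penaltyE.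
rewrite (le_trans dq_le)// ler_wpM2r// -ler_pdivlMr//.
by rewrite ge_min lexx orbT.
Unshelve. all: by end_near. Qed.


End Penalty.

(** * A locally uniform Armijo step *)

Section Armijo.
Context {R : realType} {X Y : euclideanType R}.
Variables (f : X -> R) (G : X -> Y) (C : set Y) (tau : R).
Hypotheses (f_C1 : continuously_differentiable f).
Hypotheses (G_C1 : continuously_differentiable G).
Hypotheses (C_neq0 : C !=set0) (C_closed : closed C) (C_convex : convex_set C).
Hypothesis tau_gt0 : 0 < tau.

Local Notation q := (penalty f G C tau).
Local Notation grad := (grad_penalty f G C tau).

Lemma penalty_mean_value u v d t : 0 <= t ->
  exists2 s, 0 <= s <= t &
    q (u + t *: d) v - q u v = t * inner (grad (u + s *: d) v) d.
Proof.
move=> t_ge0; pose psi (r : R) : R := q (u + r *: d) v.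
have dpsi (r : R) : is_derive r 1 psi (inner (grad (u + r *: d) v) d).
  have dq : is_diff (u + r *: d) (q ^~ v)
      (diff_penalty f G C tau (u + r *: d) v).
    exact: is_diff_penalty.
  have dline : is_diff r (cst u + *:%R ^~ d : R -> X) (0 + *:%R ^~ d).
    exact: is_diffD.
  have dpsi := is_diff_comp dline dq.
  split; first by apply: diff_derivable; exact: ex_diff.
  rewrite deriveE; last exact: ex_diff.
  rewrite (@diff_val _ _ _ _ _ _ _ dpsi)/= grad_penaltyE// fctE/= add0r.
  by rewrite scale1r.
have [|s s_itv sE] := @MVT_segment _ psi _ 0 t t_ge0 (fun r _ => dpsi r).
  apply: derivable_within_continuous => r _; apply: ex_derive.
exists s; first by rewrite in_itv/= in s_itv.
by move: sE; rewrite /psi scale0r addr0 subr0 mulrC.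
Qed.

(** By the mean value theorem the deviation of [q] from its linearization is
    governed by the variation of the gradient along the step, hence small
    uniformly around [p0]; a gradient of norm at least [delta] leaves the
    margin [(1 - gamma) c1 delta |g|] to absorb it. *)
Lemma armijo_acceptance (p0 : X * X) (c1 c2 gamma delta : R) :
    0 < c1 -> 0 < c2 -> gamma < 1 -> 0 < delta ->
  exists2 t0, 0 < t0 & \forall p \near p0, forall d t,
    delta <= `|grad p.1 p.2| ->
    inner (grad p.1 p.2) d <= - (c1 * `|grad p.1 p.2| ^+ 2) ->
    `|d| <= c2 * `|grad p.1 p.2| -> 0 <= t <= t0 ->
    q (p.1 + t *: d) p.2 <= q p.1 p.2 + gamma * t * inner (grad p.1 p.2) d.
Proof.
move=> c1_gt0 c2_gt0 gamma_lt1 delta_gt0.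
(* a variation [e] of the gradient costs at most the fraction [1 - gamma] of
   the slope *)
pose e := (1 - gamma) * c1 * delta / c2.
have e_gt0 : 0 < e by rewrite divr_gt0// !mulr_gt0// subr_gt0.
set g0 := grad p0.1 p0.2.
have [r r_gt0 rP] : exists2 r, 0 < r & forall p : X * X,
    `|p.1 - p0.1| < r -> `|p.2 - p0.2| < r -> `|grad p.1 p.2 - g0| <= e / 2.
  have := @grad_penalty_continuous _ _ _ _ _ _ _ f_C1 G_C1 C_neq0 C_closed
    C_convex tau_gt0 p0.
  move/cvgrPdist_le => /(_ (e / 2)) /(_ (divr_gt0 e_gt0 (ltr0n _ 2))).
  move=> /nbhs_ballP[r r_gt0 rP]; exists r => // p p1 p2.
  by rewrite distrC; apply: rP; split; rewrite -ball_normE/= distrC.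
(* steps up to [r / 2 / (c2 * M)] move the point by at most [r / 2] *)
pose M := `|g0| + e / 2.
have M_gt0 : 0 < M by rewrite ltr_wpDl// divr_gt0.
have r2_gt0 : 0 < r / 2 by rewrite divr_gt0.
exists (r / 2 / (c2 * M)); first by rewrite divr_gt0// mulr_gt0.
apply/nbhs_ballP; exists (r / 2) => //= p [].
rewrite -ball_normE/= distrC => p1 /ltW p2 d t.
rewrite distrC in p2.
have r2_lt : r / 2 < r by lra.
have gp_near : `|grad p.1 p.2 - g0| <= e / 2.
  by apply: rP; [exact: lt_trans p1 _|exact: le_lt_trans p2 _].
set g := grad p.1 p.2 in gp_near *.
move=> delta_le slope d_le /andP[t_ge0 t_le].
have g_le : `|g| <= M.
  by rewrite -[g](subrK g0) (le_trans (ler_normD _ _))// addrC lerD2l.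
have [s /andP[s_ge0 s_le] qE] := penalty_mean_value p.1 p.2 d t_ge0.
set gs := grad _ _ in qE.
have gs_near : `|gs - g0| <= e / 2.
  apply: (rP (p.1 + s *: d, p.2)) => /=; last exact: le_lt_trans p2 _.
  rewrite addrAC (le_lt_trans (ler_normD _ _))// (splitr r) ltr_leD//.
  rewrite normrZ ger0_norm// (le_trans (ler_wpM2l s_ge0 d_le))//.
  have cg : c2 * `|g| <= c2 * M by rewrite ler_pM2l.
  rewrite (le_trans (ler_wpM2l s_ge0 cg))// -ler_pdivlMr ?mulr_gt0//.
  exact: le_trans s_le t_le.
have gsg : `|gs - g| <= e.
  have -> : gs - g = (gs - g0) - (g - g0) by rewrite opprB addrA subrK.
  apply: le_trans (ler_normB _ _) _; rewrite [leRHS]splitr.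
  exact: lerD gs_near gp_near.
have ed : e * `|d| <= - ((1 - gamma) * inner g d).
  apply: (@le_trans _ _ (e * (c2 * `|g|))); first by rewrite ler_pM2l.
  have -> : e * (c2 * `|g|) = (1 - gamma) * (c1 * (delta * `|g|)).
    by rewrite /e; field; rewrite gt_eqF.
  rewrite -mulrN ler_pM2l ?subr_gt0// lerNr (le_trans slope)// lerN2.
  by rewrite ler_pM2l// expr2 ler_wpM2r.
have gsd : inner (gs - g) d <= e * `|d|.
  by rewrite (le_trans (inner_le _ _))// ler_wpM2r.
rewrite -lerBlDl qE -[gs](subrK g) innerDl.
have : t * (inner (gs - g) d + inner g d) <= t * (gamma * inner g d).
  rewrite ler_wpM2l// -lerBrDr (le_trans gsd)// (le_trans ed)//.
  by rewrite mulrBl mul1r opprB.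
by move/le_trans; apply; rewrite mulrCA mulrA.
Qed.

End Armijo.

(** * Finite termination of alternating minimization *)

Section AlternatingMinimization.
Context {R : realType} {X Y : euclideanType R}.
Variables (f : X -> R) (G : X -> Y) (C : set Y) (D : set X).
Variables (tau gamma beta c1 c2 : R).
Hypotheses (f_C1 : continuously_differentiable f).
Hypotheses (G_C1 : continuously_differentiable G).
Hypotheses (C_neq0 : C !=set0) (C_closed : closed C) (C_convex : convex_set C).
Hypotheses (D_neq0 : D !=set0) (D_closed : closed D).
Hypotheses (tau_gt0 : 0 < tau).
Hypotheses (gamma01 : 0 < gamma < 1) (beta01 : 0 < beta < 1).
Hypotheses (c1_gt0 : 0 < c1) (c1_le_c2 : c1 <= c2).

Local Notation q := (penalty f G C tau).
Local Notation grad := (grad_penalty f G C tau).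
Local Notation steps := (armijo_steps f G C tau gamma beta).

Definition bounded_eigenvalues (H : {linear X -> X}) :=
  self_adjoint H /\
  forall z, c1 * `|z| ^+ 2 <= inner z (H z) <= c2 * `|z| ^+ 2.

(** [- H z] is a descent direction for a function with gradient [z], and has
    length comparable to [z]. *)
Lemma bounded_eigenvalues_descent (H : {linear X -> X}) z :
    bounded_eigenvalues H ->
  inner z (- H z) <= - (c1 * `|z| ^+ 2) /\ `|- H z| <= c2 * `|z|.
Proof.
move=> [Hsa Hb]; rewrite innerNr lerN2 normrN; split.
  by case/andP: (Hb z).
apply: self_adjoint_norm_le => // [|y].
  by rewrite (le_trans (ltW c1_gt0)).
case/andP: (Hb y) => lo ->; rewrite andbT (le_trans _ lo)//.
by rewrite mulr_ge0 ?sqr_ge0// ltW.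
Qed.

(** One exponent [j] serves all points near [p0] and all admissible [H]: this
    uniformity is what bounds the steps of the algorithm away from zero near a
    cluster point. *)
Lemma backtracking_accepts (p0 : X * X) delta : 0 < delta ->
  exists j, \forall p \near p0, forall H : {linear X -> X},
    bounded_eigenvalues H -> delta <= `|grad p.1 p.2| ->
    steps p.1 p.2 (- H (grad p.1 p.2)) (beta ^+ j).
Proof.
move=> delta_gt0; have /andP[_ gamma_lt1] := gamma01.
have /andP[beta_gt0 beta_lt1] := beta01.
have c2_gt0 : 0 < c2 by exact: lt_le_trans c1_le_c2.
have [t0 t0_gt0 accept] := armijo_acceptance f_C1 G_C1 C_neq0 C_closed C_convex
  tau_gt0 p0 c1_gt0 c2_gt0 gamma_lt1 delta_gt0.
have [j jP] : exists j, beta ^+ j <= t0.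
  have : beta ^+ n @[n --> \oo] --> 0 by apply: cvg_expr; rewrite gtr0_norm.
  move=> /cvgrPdist_le/(_ _ t0_gt0)[j _ /(_ j (leqnn j))] /=.
  rewrite sub0r normrN (ger0_norm (exprn_ge0 _ (ltW beta_gt0))) => jP.
  by exists j.
exists j; apply: filterS accept => p accept H Hb delta_le.
have [slope norm_le] := bounded_eigenvalues_descent (grad p.1 p.2) Hb.
exists j => //; apply: accept => //.
by rewrite jP exprn_ge0// ltW.
Qed.

(** The trial steps decrease with the exponent, so that the least accepted
    exponent gives the largest accepted step. *)
Lemma max_armijo_step u v d j : steps u v d (beta ^+ j) ->
  exists2 alpha, steps u v d alpha & ubound (steps u v d) alpha.
Proof.
move=> stepj; have /andP[beta_gt0 beta_lt1] := beta01.
pose accepted i := `[< steps u v d (beta ^+ i) >].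
have : exists i, accepted i by exists j; apply/asboolP.
case/ex_minnP => m /asboolP stepm mP; exists (beta ^+ m) => // a stepa.
have [i aE _] := stepa; rewrite aE in stepa *.
by apply: ler_wiXn2l; [exact: ltW|exact: ltW|apply: mP; exact/asboolP].
Qed.

(** In its second variable [q] is an increasing function of the distance. *)
Lemma argmin_penalty_exists u : exists v, argmin D (q u) v.
Proof.
have [v [Dv vmin]] := nearest_point_exists D_neq0 D_closed u.
exists v; split => // v' Dv'; rewrite /penalty lerD2l ler_pM2l ?divr_gt0//.
by rewrite lerD2r ler_sqr ?nnegrE// distrC [leRHS]distrC; exact: vmin.
Qed.

Lemma iam_update_exists (H : {linear X -> X}) p :
    bounded_eigenvalues H -> grad p.1 p.2 != 0 ->
  exists p', iam_update f G C D tau gamma beta H p p'.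
Proof.
move=> Hb g_neq0.
have g_gt0 : 0 < `|grad p.1 p.2| by rewrite normr_gt0.
have [j] := backtracking_accepts p g_gt0.
move=> /nbhs_singleton/(_ H Hb (lexx _)) stepj.
have [alpha step_alpha ub_alpha] := max_armijo_step stepj.
pose u := p.1 + alpha *: (- H (grad p.1 p.2)).
have [v vmin] := argmin_penalty_exists u.
by exists (u, v), alpha.
Qed.

(** The step taken is maximal, hence at least any accepted [beta ^+ j]; the
    Armijo test turns it into a decrease, and replacing [p.2], which is a
    competitor because it lies in [D], by the minimizer [p'.2] decreases [q]
    further. *)
Lemma iam_update_decrease (H : {linear X -> X}) p p' delta j :
    bounded_eigenvalues H -> 0 <= delta <= `|grad p.1 p.2| -> D p.2 ->
    iam_update f G C D tau gamma beta H p p' ->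
    steps p.1 p.2 (- H (grad p.1 p.2)) (beta ^+ j) ->
  q p'.1 p'.2 <= q p.1 p.2 - gamma * beta ^+ j * (c1 * delta ^+ 2).
Proof.
move=> Hb /andP[delta_ge0 delta_le] Dp upd stepj.
have [alpha [[i _ accept] ub_alpha p'1 [_ p'2min]]] := upd.
have alpha_ge := ub_alpha _ stepj.
have /andP[gamma_gt0 _] := gamma01.
have /andP[beta_gt0 _] := beta01.
have [slope _] := bounded_eigenvalues_descent (grad p.1 p.2) Hb.
apply: le_trans (p'2min _ Dp) _; rewrite p'1 (le_trans accept)// lerD2l.
rewrite lerNr -mulrN (le_trans (y := gamma * alpha * (c1 * delta ^+ 2)))//.
  rewrite ler_wpM2r ?ler_wpM2l ?(ltW gamma_gt0)//.
  by rewrite mulr_ge0 ?sqr_ge0// ltW.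
rewrite ler_wpM2l//.
  rewrite mulr_ge0 ?(ltW gamma_gt0)// (le_trans _ alpha_ge)//.
  by rewrite exprn_ge0// ltW.
by rewrite lerNr (le_trans slope)// lerN2 ler_pM2l// ler_sqr ?nnegrE.
Qed.

Hypothesis f_level : forall eta, bounded_set [set x | f x <= eta].

(** The sublevel set at [f 0] is compact, and outside of it [f] exceeds [f 0]. *)
Lemma bounded_below : exists m, forall x, m <= f x.
Proof.
have fcont : continuous f.
  by move=> x; exact: differentiable_continuous (f_C1.1 x).
pose K := [set x | f x <= f 0].
have [M [_ KM]] := f_level (f 0).
have Kcompact : compact K.
  apply: (@bounded_closed_compact_euclidean _ _ _ (M + 1)).
    by move=> x Kx; apply: (KM (M + 1)) => //; rewrite ltrDl.
  apply: (@preimage_closed _ _ f [set r | r <= f 0]); last exact: closed_le.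
  by move=> x _; exact: fcont.
have [||c _ cmin] := compact_EVT_min _ Kcompact (f := f).
- by exists 0; rewrite /K/=.
- exact/continuous_subspaceT.
exists (f c) => x; have [fx|/ltW fx] := leP (f x) (f 0).
  by apply: cmin; rewrite inE.
by apply: le_trans fx; apply: cmin; rewrite inE /K/=.
Qed.

(** Descent keeps the iterates in a sublevel set of [q], and such a set is
    bounded: its first components lie in a sublevel set of [f], and the
    proximal term keeps the second components close to them. *)
Lemma sublevel_compact eta :
  exists2 K : set (X * X), compact K & forall p, q p.1 p.2 <= eta -> K p.
Proof.
have [m fm] := bounded_below.
have [M [_ fM]] := f_level eta.
pose B r := [set x : X | `|x| <= r].
have Bcompact r : compact (B r).
  apply: (@bounded_closed_compact_euclidean _ _ _ r) => //.
  apply: (@preimage_closed _ _ (fun x : X => `|x|) [set s | s <= r]).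
    by move=> x _; exact: norm_continuous.
  exact: closed_le.
pose r := M + 1 + (1 + 2 / tau * (eta - m)).
exists (B (M + 1) `*` B r) => [|p qp]; first exact: compact_setX.
have tau2_gt0 : 0 < tau / 2 by rewrite divr_gt0.
have prox : f p.1 + tau / 2 * `|p.1 - p.2| ^+ 2 <= eta.
  by rewrite (le_trans _ qp)// lerD2l ler_pM2l// lerDl sqr_ge0.
have p1 : `|p.1| <= M + 1.
  apply: fM; first by rewrite ltrDl.
  by rewrite /= (le_trans _ prox)// lerDl mulr_ge0 ?sqr_ge0// ltW.
have p12 : `|p.1 - p.2| <= 1 + 2 / tau * (eta - m).
  have : `|p.1 - p.2| ^+ 2 <= 2 / tau * (eta - m).
    rewrite -(ler_pM2l tau2_gt0) (_ : tau / 2 * (2 / tau * _) = eta - m).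
      by rewrite lerBrDl (le_trans _ prox)// lerD2r.
    by field; rewrite gt_eqF.
  have := normr_ge0 (p.1 - p.2); have := sqr_ge0 (`|p.1 - p.2| - 1); lra.
split; first exact: p1.
by rewrite /B/= /r -[p.2](subKr p.1) (le_trans (ler_normB _ _))// lerD.
Qed.

Variables (delta : R) (H : nat -> {linear X -> X}) (x0 y0 : X).
Hypotheses (delta_gt0 : 0 < delta) (Dy0 : D y0).
Hypothesis H_bnd : forall l, bounded_eigenvalues (H l).

(** A run that never stops has a cluster point, near which infinitely many
    updates decrease [q] by a fixed amount. *)
Lemma iam_terminates w :
    iam_execution f G C D tau delta gamma beta H (x0, y0) w ->
  exists N, iam_stop f G C tau delta (w N).
Proof.
move=> [w0 exec]; apply: contrapT => nostop.
have upd l : iam_update f G C D tau gamma beta (H l) (w l) (w l.+1).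
  by apply: exec => i _ stop_i; apply: nostop; exists i.
have grad_ge l : delta <= `|grad (w l).1 (w l).2|.
  by rewrite leNgt; apply/negP => /ltW stop_l; apply: nostop; exists l.
have Dw l : D (w l).2.
  by case: l => [|l]; [rewrite w0|have [alpha [_ _ _ []]] := upd l].
pose Q l := q (w l).1 (w l).2.
have QS l j :
    steps (w l).1 (w l).2 (- H l (grad (w l).1 (w l).2)) (beta ^+ j) ->
    Q l.+1 <= Q l - gamma * beta ^+ j * (c1 * delta ^+ 2).
  by apply: iam_update_decrease => //; rewrite grad_ge ltW.
have /andP[gamma_gt0 _] := gamma01.
have /andP[beta_gt0 _] := beta01.
have decr_gt0 j : 0 < gamma * beta ^+ j * (c1 * delta ^+ 2).
  by rewrite !mulr_gt0// exprn_gt0.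
have Q_noninc l : Q l.+1 <= Q l.
  have [alpha [[j aE acc] _ _ _]] := upd l.
  have stepj : steps (w l).1 (w l).2 (- H l (grad (w l).1 (w l).2)) (beta ^+ j).
    by exists j => //; rewrite -aE.
  by rewrite (le_trans (QS l j stepj))// gerBl ltW.
have Q_le i j : (i <= j)%N -> Q j <= Q i.
  by move=> ij; apply: (nonincreasing_seqP Q).1.
have [K Kcompact KP] := sublevel_compact (Q 0).
have [p [_ p_cluster]] : (K `&` cluster (w @ \oo)) !=set0.
  by apply: Kcompact; exists 0 => // l _ /=; apply: KP; exact: Q_le.
have [j stepj] := backtracking_accepts p delta_gt0.
have [m fm] := bounded_below.
have Qm l : m <= Q l.
  rewrite (le_trans (fm (w l).1))// /Q /penalty lerDl.
  by rewrite mulr_ge0 ?addr_ge0 ?sqr_ge0// divr_ge0// ltW.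
have hasinf : has_inf (range Q).
  by split; [exists (Q 0), 0|exists m => _ [l _ <-]].
(* from [N] on there is no room left below [Q l] for a decrease of the size
   guaranteed near the cluster point *)
have [_ [N _ <-] QN] := inf_adherent (decr_gt0 j) hasinf.
have tailN : (w @ \oo) (w @` [set l | (N <= l)%N]).
  by exists N => // l Nl; exists l.
have [_ [[l Nl <-] near_p]] := p_cluster _ _ tailN stepj.
have := QS l j (near_p (H l) (H_bnd l) (grad_ge l)).
have : inf (range Q) <= Q l.+1 by apply: ge_inf; [exact: hasinf.2|exists l.+1].
have := Q_le _ _ Nl; move: QN; lra.
Qed.

End AlternatingMinimization.

Theorem proposition4p5 (R : realType) (X Y : euclideanType R)
    (f : X -> R) (G : X -> Y) (C : set Y) (D : set X)
    (f_C1 : continuously_differentiable f)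
    (G_C1 : continuously_differentiable G)
    (C_neq0 : C !=set0) (C_closed : closed C) (C_convex : convex_set C)
    (D_neq0 : D !=set0) (D_closed : closed D)
    (f_level : forall eta : R, bounded_set [set x | f x <= eta])
    (tau delta gamma beta : R)
    (tau_gt0 : 0 < tau) (delta_ge0 : 0 <= delta)
    (gamma01 : 0 < gamma < 1) (beta01 : 0 < beta < 1)
    (xk yk : X) (Dyk : D yk)
    (H : nat -> {linear X -> X})
    (H_sa : forall l, self_adjoint (H l))
    (H_pd : forall l, positive_definite (H l))
    (c1 c2 : R) (c1_gt0 : 0 < c1) (c1_le_c2 : c1 <= c2)
    (H_bnd : forall (l : nat) (z : X),
       c1 * `|z| ^+ 2 <= inner z (H l z) <= c2 * `|z| ^+ 2) :
  (forall (l : nat) (p : X * X), ~ iam_stop f G C tau delta p ->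
     exists p' : X * X, iam_update f G C D tau gamma beta (H l) p p') /\
  (forall w : nat -> X * X,
     iam_execution f G C D tau delta gamma beta H (xk, yk) w ->
     (0 < delta -> exists N : nat, iam_returns_at f G C tau delta w N) /\
     (forall N : nat, iam_returns_at f G C tau delta w N ->
        `|grad_penalty f G C tau (w N).1 (w N).2| <= delta /\
        ((0 < N)%N \/ argmin D (penalty f G C tau xk) yk ->
         argmin D (penalty f G C tau (w N).1) (w N).2))).
Proof.
have Hb l : bounded_eigenvalues c1 c2 (H l) by split.
split => [l p nostop|w exec].
  apply: (iam_update_exists f_C1 G_C1 C_neq0 C_closed C_convex D_neq0 D_closed
    tau_gt0 gamma01 beta01 c1_gt0 c1_le_c2 (Hb l)).
  apply/eqP => g0; apply: nostop.
  by rewrite /iam_stop g0 normr0.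
split => [delta_gt0|N [stopN run]].
  have stops : exists N, `[< iam_stop f G C tau delta (w N) >].
    have [N stopN] := iam_terminates f_C1 G_C1 C_neq0 C_closed C_convex
      tau_gt0 gamma01 beta01 c1_gt0 c1_le_c2 f_level delta_gt0 Dyk Hb exec.
    by exists N; exact/asboolP.
  case/ex_minnP: stops => N /asboolP stopN N_min; exists N; split => // i iN.
  by move=> /asboolP/N_min; rewrite leqNgt iN.
split; first exact: stopN.
case: N run {stopN} => [|N] run.
  by case=> //; rewrite exec.1.
(* the pair [w N.+1] comes from an update, which minimizes over [D] last *)
move=> _; have [|alpha [_ _ _ //]] := exec.2 N.
by move=> i iN; apply: run; rewrite ltnS.
Qed.
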